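(* Let $p$ be an odd prime, $a\in\mathbb{Z}_p$ with $1\le\langle a\rangle_p<\frac p2$, and $a'=(a-\langle a\rangle_p)/p$. Let $Q_p(a)=\sum_{k=0}^{p-1}(a-2k)\binom ak^4$ and $S_p(x)=\sum_{k=0}^{p-1}\binom{2k}k\binom xk\binom{-1-x}k\frac1{4^k}$. Then $$\Big(\frac{Q_p(a)}p\Big)^2\equiv2^{4\langle a\rangle_p}a'^2S_p(2a)\big(1+4a'pq_p(2)+2a'(4a'-1)p^2q_p(2)^2\big)\pmod{p^3}.$$
   Context: $\mathbb{Z}_p$ denotes the set of rational numbers whose denominator is not divisible by $p$; congruences are taken in $\mathbb{Z}_p$. For $a\in\mathbb{Z}_p$, $\langle a\rangle_p$ is the unique integer in $\{0,1,\dots,p-1\}$ with $a\equiv\langle a\rangle_p\pmod p$. The general binomial coefficient is $\binom a0=1$, $\binom ak=a(a-1)\cdots(a-k+1)/k!$ for $k\ge1$. $q_p(2)=(2^{p-1}-1)/p$.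
   Formalization: The prime p = 3 is excluded: for p = 3, a = 4 the two sides are 29584 and 469000, whose difference is divisible by 9 but not by 27, so the congruence mod p^3 fails there. *)

(* Defs.v *)
From HB Require Import structures.
From mathcomp Require Import all_boot all_order all_algebra.
From mathcomp Require Import ring.

Set Implicit Arguments.
Unset Strict Implicit.
Unset Printing Implicit Defensive.

Import Order.TTheory GRing.Theory Num.Theory.

Local Open Scope ring_scope.

(* The ring of p-integral rationals (the localization of the integers at the
   prime p), not the ring of p-adic integers. [denq x] is the denominator of x
   in lowest terms, as a positive int. *)
Definition pintegral (p : nat) : {pred rat} :=
  [pred x : rat | ~~ (p %| `|denq x|)%N].

(* x = y modulo the ideal generated by p ^ n in the ring of p-integral
   rationals. *)
Definition eqmod_pint (p n : nat) (x y : rat) : bool :=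
  (x - y) / p%:R ^+ n \in pintegral p.

(* The least r in [0, p) with a = r modulo p; see [resid_uniq]. The value is p
   when there is none, which cannot happen for prime p and p-integral a. *)
Definition resid (p : nat) (a : rat) : nat :=
  find (fun r => eqmod_pint p 1 a r%:R) (iota 0 p).

Definition pquot (p : nat) (a : rat) : rat := (a - (resid p a)%:R) / p%:R.

Definition gbinom (a : rat) (k : nat) : rat :=
  (\prod_(i < k) (a - i%:R)) / k`!%:R.

Definition fermat_quot2 (p : nat) : rat := (2 ^+ p.-1 - 1) / p%:R.

Definition Qsum (p : nat) (a : rat) : rat :=
  \sum_(k < p) (a - 2 * k%:R) * gbinom a k ^+ 4.

Definition Ssum (p : nat) (x : rat) : rat :=
  \sum_(k < p) 'C(2 * k, k)%:R * gbinom x k * gbinom (- 1 - x) k / 4 ^+ k.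

Lemma pintegralP (p : nat) (x : rat) :
  reflect (exists n d : int, ~~ (p %| `|d|)%N /\ x = n%:~R / d%:~R)
          (x \in pintegral p).
Proof.
apply: (iffP idP) => [xp|[n [d [pd ->]]]].
  by exists (numq x), (denq x); split; [exact: xp | rewrite divq_num_den].
move: pd; rewrite inE /=; case: divqP => [_|k y k0]; first by rewrite dvdn0.
by apply: contra => py; rewrite abszM dvdn_mull.
Qed.

Lemma pintegralB (p : nat) (x y : rat) : prime p ->
  x \in pintegral p -> y \in pintegral p -> x - y \in pintegral p.
Proof.
move=> p_pr /pintegralP[n [d [pd ->]]] /pintegralP[m [e [pe ->]]].
apply/pintegralP; exists (n * e - m * d), (d * e).
have nz (k : int) : ~~ (p %| `|k|)%N -> k%:~R != 0 :> rat.
  by rewrite intr_eq0; apply: contraNneq => ->; rewrite dvdn0.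
split; first by rewrite abszM Euclid_dvdM // negb_or pd.
by rewrite rmorphB !rmorphM /=; field; rewrite !nz.
Qed.

Lemma resid_uniq (p : nat) (a : rat) (r : nat) : prime p -> a \in pintegral p ->
  (resid p a == r) = (r < p)%N && eqmod_pint p 1 a r%:R.
Proof.
move=> p_pr ap.
have p0 : p%:R != 0 :> rat by rewrite pnatr_eq0 -lt0n prime_gt0.
have ex : has (fun r => eqmod_pint p 1 a r%:R) (iota 0 p).
  have [n [d [pd ->]]] := pintegralP _ _ ap.
  have d0 : d%:~R != 0 :> rat.
    by rewrite intr_eq0; apply: contraNneq pd => ->; rewrite dvdn0.
  have cop : coprimez d p by rewrite coprimezE coprime_sym prime_coprime.
  have [[u v] /= uv] := coprimezP _ _ cop.
  have r0 : (0 <= (n * u %% p)%Z) by apply: modz_ge0; rewrite -lt0n prime_gt0.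
  apply/hasP; exists `|(n * u %% p)%Z|%N.
    by rewrite mem_iota /= add0n -ltz_nat gez0_abs // ltz_pmod ?ltz_nat ?prime_gt0.
  apply/pintegralP; exists (n * v + (n * u %/ p)%Z * d), d; split => //.
  have -> : (`|(n * u %% p)%Z|%N)%:R = (n * u %% p)%Z%:~R :> rat.
    by rewrite -[in RHS](gez0_abs r0).
  rewrite expr1.
  have key : n - (n * u %% p)%Z * d = (n * v + (n * u %/ p)%Z * d) * p.
    have E := divz_eq (n * u) p.
    have -> : (n * u %% p)%Z = n * u - (n * u %/ p)%Z * p.
      by rewrite [X in X - _]E addrC addKr.
    rewrite -[X in X - _]mulr1 -uv; ring.
  apply: (mulIf p0); rewrite divfK //; apply: (mulIf d0).
  by rewrite mulrBl divfK // mulrAC divfK // -[p%:R]/((p : int)%:~R) -!rmorphM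
             -rmorphB key.
have lt_res : (resid p a < p)%N by move: ex; rewrite has_find size_iota.
have res : eqmod_pint p 1 a (resid p a)%:R.
  by have := nth_find 0 ex; rewrite nth_iota.
apply/eqP/andP => [<-//|[lt_r ar]].
have : (r%:Z - (resid p a)%:Z)%:~R / p%:R \in pintegral p.
  have := pintegralB p_pr res ar; rewrite -mulrBl expr1.
  by rewrite opprB addrC addrA subrK rmorphB.
move/pintegralP => [n [d [pd]]] /eqP.
have d0 : d%:~R != 0 :> rat.
  by rewrite intr_eq0; apply: contraNneq pd => ->; rewrite dvdn0.
rewrite eqr_div // -[p%:R]/((p : int)%:~R) -!rmorphM /= eqr_int => /eqP E.
have : (p %| `|((r%:Z - (resid p a)%:Z) * d)%R|)%N by rewrite E abszM dvdn_mull.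
rewrite abszM Euclid_dvdM // (negPf pd) orbF => pr.
have : (p %| r%:Z - (resid p a)%:Z)%Z by exact: pr.
by rewrite -eqz_mod_dvd !modz_small //= => /eqP[].
Qed.

(* Main.v *)
From HB Require Import structures.
Require Import Defs.
From mathcomp Require Import all_boot all_order all_algebra.
From mathcomp Require Import ring lra zify.
Import Order.TTheory GRing.Theory Num.Theory.
Local Open Scope ring_scope.

(** Write [a = r + p t] and [m = (p - 1) / 2]. Both sums satisfy first-order
    recurrences (in [a -> a + 1] for [Qsum], in [x -> x + 2] for [Ssum]) whose
    truncation at [k < p] only adds a boundary term, which vanishes modulo
    [p ^ 4], resp. [p ^ 3], as long as the residues stay away from [p - 1].
    This reduces [Qsum p a] to [Qsum p (p t) = p t] and [Ssum p (2 a)] to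
    [Ssum p (2 p t)], with products of rational factors that match after
    squaring.

    Modulo [p ^ 3], [Ssum p (p s) = 1 - p s H - (p s) ^ 2 K] for two sums [H]
    and [K] independent of [s]. An identity for
    [sum_k (-1)^k C(n, k) / k ^ 2] gives [K = - 2 q ^ 2] modulo [p]. For [H],
    take [s = - 1]: by the symmetry [x -> - 1 - x] and the recurrence,
    [Ssum p (- p) = Ssum p (p - 1) = (C(2m, m) / 4 ^ m) ^ 2], which is
    [(1 + p q) ^ 2] by Morley's congruence. The latter comes from
    [L z = prod_(1 <= j <= m) (1 - p z / j)]: exactly
    [L 1 = (1 + p q) L (1 / 2)], while [L (1 / 2) ^ 2 = L 1] modulo [p ^ 3]
    because [sum_(j <= m) 1 / j ^ 2 = 0] modulo [p]. *)

(** * Binomial coefficients with rational upper argument *)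

Lemma gbinom0 (a : rat) : gbinom a 0 = 1.
Proof. by rewrite /gbinom big_ord0 fact0 divr1. Qed.

Lemma natS_neq0 (k : nat) : 1 + k%:R != 0 :> rat.
Proof. by rewrite nat1r pnatr_eq0. Qed.

Lemma doubleS_neq0 (k : nat) : 2 * k%:R + 2 != 0 :> rat.
Proof. by rewrite -natrM -natrD pnatr_eq0 addnC. Qed.

Lemma gbinomS (a : rat) (k : nat) :
  gbinom a k.+1 = gbinom a k * (a - k%:R) / k.+1%:R.
Proof.
rewrite /gbinom big_ord_recr /= factS natrM.
by field; rewrite natS_neq0 pnatr_eq0 -lt0n fact_gt0.
Qed.

Lemma gbinomSS (a : rat) (k : nat) :
  gbinom (a + 1) k.+1 = (a + 1) / k.+1%:R * gbinom a k.
Proof.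
rewrite /gbinom big_ord_recl /= subr0 factS natrM.
rewrite (eq_bigr (fun i : 'I_k => a - i%:R)) => [|i _]; last first.
  by rewrite /bump /= -nat1r; ring.
by field; rewrite natS_neq0 pnatr_eq0 -lt0n fact_gt0.
Qed.

(** Compares two expansions of [gbinom (a + 1) k.+1]; it shifts the upper argument without dividing
    by a factor that may vanish. *)
Lemma gbinom_absorb (a : rat) (k : nat) :
  (a + 1) * gbinom a k = gbinom (a + 1) k * (a + 1 - k%:R).
Proof.
have := gbinomSS a k; rewrite gbinomS -nat1r => /(congr1 ( *%R^~ (1 + k%:R))).
by rewrite divfK ?natS_neq0 // => ->; field; rewrite natS_neq0.
Qed.

Lemma gbinom_nat (n k : nat) : gbinom n%:R k = 'C(n, k)%:R.
Proof.
elim: k => [|k IHk]; first by rewrite gbinom0 bin0.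
rewrite gbinomS IHk; apply: (mulIf (x := k.+1%:R)); first by rewrite pnatr_eq0.
rewrite divfK ?pnatr_eq0 // -natrM [('C(n, k.+1) * _)%N]mulnC mul_bin_left natrM.
have [le_kn|lt_nk] := leqP k n; first by rewrite natrB // mulrC.
by rewrite bin_small // mul0r mulr0.
Qed.

(** * Recurrence in a for the terms of [Qsum] *)

Definition qterm (a : rat) (k : nat) : rat := (a - 2 * k%:R) * gbinom a k ^+ 4.

(** A Zeilberger-type certificate: both terms at k = n + 1 are rational multiples of
    [gbinom a n ^+ 4], so the induction step is one rational identity. *)
Lemma qterm_telescope (a : rat) (n : nat) :
  \sum_(k < n.+1) ((a + 1) * qterm (a + 1) k + 2 * (2 * a + 1) * qterm a k) =
  (2 * n.+1%:R ^+ 2 - 6 * (a + 1) * n.+1%:R + 5 * (a + 1) ^+ 2)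
    * gbinom a n ^+ 4.
Proof.
elim: n => [|n IHn].
  rewrite big_ord1 /qterm !gbinom0 /=; ring.
rewrite big_ord_recr /= IHn /qterm gbinomSS gbinomS -!nat1r.
by field; rewrite natS_neq0.
Qed.

(** * Recurrence in x for the terms of [Ssum] *)

Definition cbin (k : nat) : rat := 'C(2 * k, k)%:R / 4 ^+ k.

Lemma cbin0 : cbin 0 = 1.
Proof. by rewrite /cbin bin0 divr1. Qed.

Lemma cbinS (k : nat) :
  cbin k.+1 = cbin k * (2 * k%:R + 1) / (2 * k%:R + 2).
Proof.
have E : ((k.+1 * 'C(2 * k.+1, k.+1)) = 2 * ((2 * k + 1) * 'C(2 * k, k)))%N.
  have -> : (2 * k.+1 = (2 * k).+2)%N by lia.
  rewrite -mul_bin_diag /= addn1 (mul_bin_down (2 * k).+1).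
  have -> : ((2 * k).+1 - k = k.+1)%N by lia.
  by lia.
have := congr1 (fun n : nat => n%:R : rat) E; rewrite /= !natrM => E'.
have -> : cbin k.+1 = (k.+1%:R * 'C(2 * k.+1, k.+1)%:R) / k.+1%:R / 4 ^+ k.+1.
  by rewrite /cbin; field; rewrite natS_neq0 expf_eq0 andbF.
rewrite E' /cbin exprS natrD natrM -nat1r; field.
by rewrite natS_neq0 expf_eq0 andbF doubleS_neq0.
Qed.

Definition sterm (x : rat) (k : nat) : rat :=
  cbin k * gbinom x k * gbinom (- 1 - x) k.

Lemma SsumE (p : nat) (x : rat) : Ssum p x = \sum_(k < p) sterm x k.
Proof. by apply: eq_bigr => k _; rewrite /sterm /cbin; ring. Qed.

Lemma sterm_telescope (x : rat) (n : nat) :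
  \sum_(k < n.+1) ((x + 2) ^+ 2 * sterm (x + 2) k - (x + 1) ^+ 2 * sterm x k) =
  (2 * x + 3) * (2 * n%:R + 1) * sterm (x + 1) n.
Proof.
elim: n => [|n IHn].
  rewrite big_ord1 /sterm !gbinom0 cbin0 /=; ring.
rewrite big_ord_recr /= IHn /sterm !cbinS.
(* These are the binomials in [sterm (x + 1) n]; all others are expressed through them. [gbinomSS]
   on one factor supplies the multiplier that [gbinom_absorb] consumes on the other. *)
pose u := gbinom (x + 1) n; pose w := gbinom (- 2 - x) n.
have E0 : gbinom x n.+1 * gbinom (- 1 - x) n.+1 =
    - ((x + 1 - n%:R) * (x - n%:R) * u * w / n.+1%:R ^+ 2).
  have -> : - 1 - x = (- 2 - x) + 1 by ring.
  rewrite gbinomSS gbinomS.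
  have := gbinom_absorb x n; rewrite -/u -/w => E.
  transitivity (- (((x + 1) * gbinom x n) * (x - n%:R) * w / n.+1%:R ^+ 2)).
    by rewrite -nat1r; field; rewrite natS_neq0.
  by rewrite E; ring.
have E2 : gbinom (x + 2) n.+1 * gbinom (- 1 - (x + 2)) n.+1 =
    - ((- 2 - x - n%:R) * (- 3 - x - n%:R) * u * w / n.+1%:R ^+ 2).
  have -> : x + 2 = (x + 1) + 1 by ring.
  have -> : - 1 - (x + 1 + 1) = - 3 - x by ring.
  rewrite gbinomSS gbinomS.
  have := gbinom_absorb (- 3 - x) n.
  have -> : - 3 - x + 1 = - 2 - x by ring.
  rewrite -/u -/w => E.
  transitivity (- (((- 2 - x) * gbinom (- 3 - x) n) * (- 3 - x - n%:R) * u
                   / n.+1%:R ^+ 2)).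
    by rewrite -nat1r; field; rewrite natS_neq0.
  by rewrite E; ring.
have -> : - 1 - (x + 1) = - 2 - x by ring.
rewrite (gbinomS (x + 1)) (gbinomS (- 2 - x)) -/u -/w.
rewrite -[X in (x + 2) ^+ 2 * X]mulrA E2 -[X in (x + 1) ^+ 2 * X]mulrA E0 -nat1r.
field.
by rewrite natS_neq0 doubleS_neq0.
Qed.

(** * Alternating binomial sums and harmonic sums *)

Lemma altsum_gbinom (a : rat) (n : nat) :
  \sum_(k < n) (- 1) ^+ k.+1 * gbinom (a + 1) k.+1 = (- 1) ^+ n * gbinom a n - 1.
Proof.
elim: n => [|n IHn]; first by rewrite big_ord0 gbinom0 mulr1 subrr.
rewrite big_ord_recr /= IHn gbinomSS gbinomS exprS -nat1r.
by field; rewrite natS_neq0.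
Qed.

Definition harmonic (j n : nat) : rat := \sum_(k < n) k.+1%:R ^- j.

(** Since C(n, k) / (k + 1) = C(n + 1, k + 1) / (n + 1), passing from n to n + 1 adds an alternating
    binomial sum divided by n + 1. A bound N independent of n keeps the range fixed during the
    induction. *)
Lemma altsum_bin1 (N n : nat) : (n <= N)%N ->
  \sum_(k < N) (- 1) ^+ k.+1 * gbinom n%:R k.+1 / k.+1%:R = - harmonic 1 n.
Proof.
elim: n => [_|n IHn lt_nN].
  rewrite /harmonic big_ord0 oppr0 big1 // => k _.
  by rewrite gbinom_nat bin0n mulr0 mul0r.
rewrite /harmonic big_ord_recr opprD -/(harmonic 1 n) -IHn 1?ltnW //=.
(* As n < N, C(n, N) = 0 and the alternating sum is -1. *)
have <- : (\sum_(k < N) (- 1) ^+ k.+1 * gbinom (n%:R + 1) k.+1) / n.+1%:R =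
    - n.+1%:R ^- 1 :> rat.
  by rewrite altsum_gbinom gbinom_nat bin_small // mulr0 sub0r mulN1r expr1.
rewrite mulr_suml -big_split; apply: eq_bigr => k _ /=.
rewrite -[n.+1]addn1 natrD gbinomSS gbinomS -nat1r; field.
by rewrite natS_neq0 addrC natS_neq0.
Qed.

(** By the same identity, the increment from n to n + 1 is the sum of [altsum_bin1] at n + 1,
    divided by n + 1. *)
Lemma altsum_bin2 (N n : nat) : (n <= N)%N ->
  \sum_(k < N) (- 1) ^+ k.+1 * gbinom n%:R k.+1 / k.+1%:R ^+ 2 =
  - ((harmonic 1 n ^+ 2 + harmonic 2 n) / 2).
Proof.
elim: n => [_|n IHn lt_nN].
  rewrite /harmonic !big_ord0 big1 => [|k _];
    first by rewrite expr0n addr0 mul0r oppr0.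
  by rewrite gbinom_nat bin0n mulr0 mul0r.
have H1S : harmonic 1 n.+1 = harmonic 1 n + n.+1%:R^-1.
  by rewrite /harmonic big_ord_recr /= expr1.
have -> : harmonic 2 n.+1 = harmonic 2 n + n.+1%:R ^- 2.
  by rewrite /harmonic big_ord_recr.
transitivity (- ((harmonic 1 n ^+ 2 + harmonic 2 n) / 2)
              + (- harmonic 1 n.+1) / n.+1%:R); last first.
  by rewrite H1S -nat1r; field; rewrite natS_neq0.
rewrite -IHn 1?ltnW // -(altsum_bin1 _ _ lt_nN) mulr_suml -big_split.
apply: eq_bigr => k _ /=.
rewrite -[n.+1]addn1 natrD gbinomSS gbinomS -nat1r; field.
by rewrite natS_neq0 addrC natS_neq0.
Qed.

Lemma sterm_sym (x : rat) (k : nat) : sterm (- 1 - x) k = sterm x k.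
Proof. by rewrite /sterm subKr mulrAC. Qed.

(** * Congruences between p-integral rationals *)

Section Congruences.

Set Implicit Arguments.
Unset Strict Implicit.

Variables (p : nat) (p_pr : prime p).

Local Notation pint := (pintegral p).
Local Notation P := (p%:R : rat).
Local Notation "x == y %[pmod n ]" := (eqmod_pint p n x y)
  (at level 70, y at next level, format "x  ==  y  %[pmod  n ]").

Lemma pintegral_subring : subring_closed pint.
Proof.
split=> [|x y|x y]; [|exact: pintegralB|].
  apply/pintegralP; exists 1, 1; split; last by rewrite divr1.
  by rewrite dvdn1 gtn_eqF // prime_gt1.
move=> /pintegralP[n [d [pd ->]]] /pintegralP[m [e [pe ->]]].
apply/pintegralP; exists (n * m), (d * e).
split; first by rewrite abszM Euclid_dvdM // negb_or pd.
by rewrite !rmorphM /= invfM mulrACA.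
Qed.

HB.instance Definition _ :=
  GRing.isSubringClosed.Build rat pint pintegral_subring.

Lemma prime_neq0 : P != 0.
Proof. by rewrite pnatr_eq0 -lt0n prime_gt0. Qed.

(** For z = u / d the numerator n d + p u is prime to p. This handles the denominators
    [i.+1%:R + P * t] of the recurrences. *)
Lemma pintegral_unit (n : nat) (z : rat) : (0 < n < p)%N -> z \in pint ->
  n%:R + P * z != 0 /\ (n%:R + P * z)^-1 \in pint.
Proof.
move=> /andP[n0 ltn] /pintegralP[u [d [pd ->]]].
have d0 : d%:~R != 0 :> rat.
  by rewrite intr_eq0; apply: contraNneq pd => ->; rewrite dvdn0.
pose N : int := n%:Z * d + p%:Z * u.
have pN : ~~ (p %| `|N|)%N.
  have -> : (p %| `|N|)%N = (p %| n%:Z * d)%Z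
    by rewrite -(rpredDr _ (dvdz_mulr u (dvdzz p%:Z))).
  by rewrite dvdzE abszM Euclid_dvdM // negb_or pd andbT gtnNdvd.
have N0 : N%:~R != 0 :> rat.
  by rewrite intr_eq0; apply: contraNneq pN => ->; rewrite dvdn0.
have E : n%:R + P * (u%:~R / d%:~R) = N%:~R / d%:~R.
  by rewrite /N rmorphD !rmorphM /=; field.
rewrite E; split; first by rewrite mulf_neq0 ?invr_eq0.
by apply/pintegralP; exists d, N; rewrite invf_div.
Qed.

Lemma eqm_refl n x : x == x %[pmod n].
Proof. by rewrite /eqmod_pint subrr mul0r rpred0. Qed.

Lemma eqm_sym n x y : (x == y %[pmod n]) = (y == x %[pmod n]).
Proof. by rewrite /eqmod_pint -opprB mulNr rpredN. Qed.

Lemma eqmD n x y z w :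
  x == y %[pmod n] -> z == w %[pmod n] -> x + z == y + w %[pmod n].
Proof.
by move=> xy zw; rewrite /eqmod_pint opprD addrACA mulrDl rpredD.
Qed.

Lemma eqm_trans n y x z :
  x == y %[pmod n] -> y == z %[pmod n] -> x == z %[pmod n].
Proof.
by move=> xy yz; rewrite /eqmod_pint -[x](subrK y) -addrA mulrDl rpredD.
Qed.

Lemma eqmMl n c x y :
  c \in pint -> x == y %[pmod n] -> c * x == c * y %[pmod n].
Proof. by move=> cp xy; rewrite /eqmod_pint -mulrBr -mulrA rpredM. Qed.

Lemma eqmM n x y z w : z \in pint -> y \in pint ->
  x == y %[pmod n] -> z == w %[pmod n] -> x * z == y * w %[pmod n].
Proof.
move=> zp yp xy zw; apply: eqm_trans (eqmMl yp zw).
by rewrite ![_ * z]mulrC; exact: eqmMl.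
Qed.

Lemma eqm_sum n m (F G : 'I_m -> rat) :
  (forall i, F i == G i %[pmod n]) ->
  \sum_(i < m) F i == \sum_(i < m) G i %[pmod n].
Proof.
by move=> FG; rewrite /eqmod_pint -sumrB mulr_suml rpred_sum // => i _; exact: FG.
Qed.

Lemma eqm_pint n x y : y \in pint -> x == y %[pmod n] -> x \in pint.
Proof.
move=> yp xy; rewrite -[x](subrK y) rpredD //.
have p0 : P ^+ n != 0 by rewrite expf_neq0 // prime_neq0.
by rewrite -[x - y](divfK p0) rpredM // rpredX // rpred_nat.
Qed.

Lemma eqm_prod n m (F G : 'I_m -> rat) :
  (forall i, G i \in pint) -> (forall i, F i == G i %[pmod n]) ->
  \prod_(i < m) F i == \prod_(i < m) G i %[pmod n].
Proof.
move=> Gp FG; elim: m => [|m IHm] in F G Gp FG *;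
  first by rewrite !big_ord0 eqm_refl.
rewrite !big_ord_recr /=; apply: eqmM => //; first by apply: eqm_pint (FG _).
- by rewrite rpred_prod.
- exact: IHm.
Qed.

(** Most explicit congruences below are proved by exhibiting the quotient e, which leaves an
    equation for [ring] or [field]; [eqm_quotP] goes back. *)
Lemma eqm_quot n e x y :
  e \in pint -> x = y + P ^+ n * e -> x == y %[pmod n].
Proof.
move=> ep ->; rewrite /eqmod_pint addrC addKr mulrC mulKf //.
by rewrite expf_neq0 // prime_neq0.
Qed.

Lemma eqm_quotP n x y :
  x == y %[pmod n] -> exists2 e, e \in pint & x = y + P ^+ n * e.
Proof.
move=> xy; exists ((x - y) / P ^+ n); first exact: xy.
by rewrite [P ^+ n * _]mulrC divfK ?expf_neq0 ?prime_neq0 // addrC subrK.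
Qed.

Lemma eqm_scale n k x y :
  (P ^+ k * x == P ^+ k * y %[pmod k + n]) = (x == y %[pmod n]).
Proof.
rewrite /eqmod_pint -mulrBr exprD invfM mulrACA divff ?mul1r //.
by rewrite expf_neq0 // prime_neq0.
Qed.

Lemma eqm_weak n k x y : (k <= n)%N -> x == y %[pmod n] -> x == y %[pmod k].
Proof.
move=> le_kn /eqm_quotP[e ep ->].
apply: (@eqm_quot _ (P ^+ (n - k) * e));
  first by rewrite rpredM // rpredX // rpred_nat.
by rewrite mulrA -exprD subnKC.
Qed.


Lemma eqm0M k n x y : x == 0 %[pmod k] -> y == 0 %[pmod n] ->
  x * y == 0 %[pmod k + n].
Proof.
move=> /eqm_quotP[e ep ->] /eqm_quotP[f fp ->].
apply: (@eqm_quot _ (e * f)); first exact: rpredM.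
by rewrite exprD; ring.
Qed.

Lemma eqm0Ml n x y : x == 0 %[pmod n] -> y \in pint -> x * y == 0 %[pmod n].
Proof. by move=> x0 yp; rewrite mulrC -[0](mulr0 y); exact: eqmMl. Qed.

Lemma eqm0X n x : x == 0 %[pmod 1] -> x ^+ n == 0 %[pmod n].
Proof.
move=> x0; elim: n => [|n IHn]; last by rewrite exprS; exact: (eqm0M x0).
by apply: (@eqm_quot _ 1); rewrite ?rpred1 // !expr0 mulr1 add0r.
Qed.

Lemma eqm0P t : t \in pint -> P * t == 0 %[pmod 1].
Proof. by move=> tp; apply: (eqm_quot tp); rewrite add0r. Qed.

Lemma eqm_sum0 n k (F : 'I_k -> rat) :
  (forall i, F i == 0 %[pmod n]) -> \sum_(i < k) F i == 0 %[pmod n].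
Proof. by move=> F0; have := eqm_sum F0; rewrite big1_eq. Qed.

Lemma eqm_prod1 n k (F : 'I_k -> rat) :
  (forall i, F i == 1 %[pmod n]) -> \prod_(i < k) F i == 1 %[pmod n].
Proof.
by move=> F1; have := eqm_prod (fun=> rpred1 _) F1; rewrite big1_eq; apply.
Qed.

Lemma pintPM t : t \in pint -> P * t \in pint.
Proof. by move=> tp; rewrite rpredM // rpred_nat. Qed.

Lemma pint_invn k : (0 < k < p)%N -> k%:R^-1 \in pint.
Proof. by move=> /pintegral_unit/(_ (rpred0 _))[_]; rewrite mulr0 addr0. Qed.

Lemma gbinom_pint a k : a \in pint -> (k < p)%N -> gbinom a k \in pint.
Proof.
move=> ap; elim: k => [_|k IHk lt_kp]; first by rewrite gbinom0 rpred1.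
rewrite gbinomS rpredM ?pint_invn // rpredM ?IHk 1?ltnW //.
by rewrite rpredB // rpred_nat.
Qed.

(** For k > r the numerator contains the factor a - r = p t, while k! is prime to p. *)
Lemma gbinom_eqm0 r t k : t \in pint -> (r < k < p)%N ->
  gbinom (r%:R + P * t) k == 0 %[pmod 1].
Proof.
move=> tp; elim: k => [|k IHk] /andP[// lt_rk lt_kp].
have ap : r%:R + P * t \in pint by rewrite rpredD ?rpred_nat ?pintPM.
have gp : gbinom (r%:R + P * t) k \in pint.
  by apply: gbinom_pint => //; exact: ltnW.
rewrite gbinomS; apply: eqm0Ml; last exact: pint_invn.
move: lt_rk; rewrite ltnS leq_eqVlt => /predU1P[eq_rk|lt_rk].
  have -> : r%:R + P * t - k%:R = P * t by rewrite eq_rk; ring.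
  by rewrite mulrC; apply: eqm0Ml (eqm0P tp) gp.
by apply: eqm0Ml; [apply: IHk; rewrite lt_rk ltnW | rewrite rpredB ?rpred_nat].
Qed.

(** Inverses are closed only by [assumption]: their integrality is put in the context beforehand,
    and [exprVn] turns inverses of powers into powers of inverses. *)
Ltac integrality := repeat match goal with
  | |- is_true (_%:R \in _) => exact: rpred_nat
  | |- is_true (1 \in _) => exact: rpred1
  | |- is_true (0 \in _) => exact: rpred0
  | |- is_true (_ ^+ _ \in _) => apply: rpredX
  | |- is_true (_ * _ \in _) => apply: rpredM
  | |- is_true (_ + _ \in _) => apply: rpredD
  | |- is_true (- _ \in _) => rewrite rpredN
  | |- _ => assumption
  end.

(** * Reduction of [Qsum] to the residue 0 *)

Lemma p_predK : p.-1.+1 = p.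
Proof. by rewrite prednK // prime_gt0. Qed.

Lemma sum_p_recl (F : nat -> rat) :
  \sum_(k < p) F k = F 0%N + \sum_(k < p.-1) F k.+1.
Proof. by rewrite -(big_mkord xpredT F) big_ltn ?prime_gt0 // big_add1 big_mkord. Qed.

(** The residue i of a is below p - 1, so p divides [gbinom a p.-1], which enters the boundary term
    to the fourth power. *)
Lemma Qsum_step i t : t \in pint -> (i.+1 < p)%N ->
  Qsum p (i.+1%:R + P * t) ==
    - (2 * (2 * (i%:R + P * t) + 1) / (i.+1%:R + P * t)) * Qsum p (i%:R + P * t)
  %[pmod 4].
Proof.
move=> tp lt_ip; set a := i%:R + P * t.
have -> : i.+1%:R + P * t = a + 1 by rewrite /a -nat1r; ring.
have ap : a \in pint by rewrite rpredD ?rpred_nat ?pintPM.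
have [nz invp] : a + 1 != 0 /\ (a + 1)^-1 \in pint.
  have -> : a + 1 = i.+1%:R + P * t by rewrite /a -nat1r; ring.
  exact: pintegral_unit.
have tele := qterm_telescope a p.-1.
rewrite p_predK big_split /= -!mulr_sumr in tele.
(* The polynomial factor of [qterm_telescope] at n = p - 1, divided by the leading coefficient a +
   1. *)
pose e := (2 * P ^+ 2 - 6 * (a + 1) * P + 5 * (a + 1) ^+ 2) / (a + 1).
have ep : e \in pint.
  by rewrite /e; integrality.
have E : Qsum p (a + 1) =
    - (2 * (2 * a + 1) / (a + 1)) * Qsum p a + gbinom a p.-1 ^+ 4 * e.
  apply: (mulfI nz); rewrite -/(qterm _) /e.
  have -> : Qsum p (a + 1) = \sum_(k < p) qterm (a + 1) k by [].
  have -> : Qsum p a = \sum_(k < p) qterm a k by [].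
  by rewrite (canRL (addrK _) tele); field.
rewrite E -[X in eqmod_pint _ _ _ X]addr0; apply: eqmD; first exact: eqm_refl.
apply: eqm0Ml => //; apply: eqm0X; apply: gbinom_eqm0 => //.
by move: lt_ip; clear; lia.
Qed.

Lemma Qsum_base t : t \in pint -> Qsum p (P * t) == P * t %[pmod 4].
Proof.
move=> tp; rewrite -[Qsum _ _]/(\sum_(k < p) qterm (P * t) k) sum_p_recl.
rewrite -[X in eqmod_pint _ _ _ X]addr0; apply: eqmD.
  by rewrite /qterm gbinom0 mulr0 subr0 expr1n mulr1 eqm_refl.
apply: eqm_sum0 => i; rewrite /qterm mulrC; apply: eqm0Ml;
  last by have := pintPM tp => ?; integrality.
apply: eqm0X; rewrite -[P * t]add0r; apply: (@gbinom_eqm0 0%N) => //=.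
by rewrite -[X in (_ < X)%N]p_predK ltnS.
Qed.

Lemma Qsum_prod r t : t \in pint -> (r < p)%N ->
  Qsum p (r%:R + P * t) ==
    P * t * \prod_(i < r)
      (- (2 * (2 * (i%:R + P * t) + 1) / (i.+1%:R + P * t))) %[pmod 4].
Proof.
move=> tp; elim: r => [_|r IHr lt_rp].
  by rewrite big_ord0 mulr1 add0r; exact: Qsum_base.
rewrite big_ord_recr /= mulrA [_ * - _]mulrC.
apply: eqm_trans (Qsum_step tp lt_rp) _; apply: eqmMl (IHr (ltnW lt_rp)).
by have [_ invp] := pintegral_unit (n := r.+1) lt_rp tp; integrality.
Qed.

(** * Central binomials modulo p and reduction of [Ssum] *)

Lemma cbin_prod k : cbin k = \prod_(i < k) ((2 * i%:R + 1) / (2 * i%:R + 2)).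
Proof.
elim: k => [|k IHk]; first by rewrite cbin0 big_ord0.
by rewrite big_ord_recr /= -IHk cbinS mulrA.
Qed.

Lemma gbinom_prod a k :
  (- 1) ^+ k * gbinom a k = \prod_(i < k) ((i%:R - a) / i.+1%:R).
Proof.
elim: k => [|k IHk]; first by rewrite gbinom0 big_ord0 mulr1.
by rewrite big_ord_recr /= -IHk gbinomS exprS; ring.
Qed.

Variables (m : nat) (p_eq : p = (2 * m).+1).

Lemma pint_inv2 : 2^-1 \in pint.
Proof. by apply: (@pint_invn 2); have := prime_gt1 p_pr; lia. Qed.

Lemma PE : P = 2 * m%:R + 1.
Proof. by rewrite p_eq -nat1r natrM addrC. Qed.

(** [cbin k] is (-1)^k C(-1/2, k), and m = -1/2 modulo p. The factors (2i + 1) / (2i + 2) and (i -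
    m) / (i + 1) differ by p / (2 (i + 1)). *)
Lemma cbin_gbinom k : (k < p)%N ->
  cbin k == (- 1) ^+ k * gbinom m%:R k %[pmod 1].
Proof.
move=> lt_kp; rewrite cbin_prod gbinom_prod.
have inv_pint (i : 'I_k) : i.+1%:R^-1 \in pint.
  by apply: pint_invn; rewrite /= (leq_ltn_trans (ltn_ord i) lt_kp).
have inv2_pint := pint_inv2.
apply: eqm_prod => i;
  first by have := inv_pint i => ?; integrality.
apply: (@eqm_quot _ (2^-1 * i.+1%:R^-1));
  first by have := inv_pint i => ?; integrality.
by rewrite PE -nat1r; field; rewrite natS_neq0 doubleS_neq0.
Qed.

Lemma cbin_pint k : (k < p)%N -> cbin k \in pint.
Proof.
move=> lt_kp; apply: eqm_pint (cbin_gbinom lt_kp).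
by rewrite rpredM ?rpredX ?rpredN ?rpred1 // gbinom_pint ?rpred_nat.
Qed.

Lemma m_gt0 : (0 < m)%N.
Proof. by have := prime_gt1 p_pr; lia. Qed.

Lemma cbin_predp : cbin p.-1 == 0 %[pmod 1].
Proof.
have := @cbin_gbinom p.-1; rewrite gbinom_nat bin_small ?mulr0; last first.
  by have := m_gt0; lia.
by apply; rewrite p_predK.
Qed.

(** Each of the three factors of the boundary term [sterm (x + 1) p.-1] is divisible by p. *)
Lemma Ssum_step j s : s \in pint -> (j.+2 < p)%N ->
  Ssum p (j.+2%:R + P * s) ==
    ((j.+1%:R + P * s) / (j.+2%:R + P * s)) ^+ 2 * Ssum p (j%:R + P * s)
  %[pmod 3].
Proof.
move=> sp lt_jp; set x := j%:R + P * s.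
have E1 : j.+1%:R + P * s = x + 1 by rewrite /x -nat1r; ring.
have E2 : j.+2%:R + P * s = x + 2 by rewrite /x -!nat1r; ring.
have [nz invp] := pintegral_unit (n := j.+2) lt_jp sp.
rewrite E2 in nz invp.
rewrite E1 E2 !SsumE.
have xp : x \in pint by rewrite rpredD ?rpred_nat ?pintPM.
have tele := sterm_telescope x p.-1.
rewrite p_predK sumrB -!mulr_sumr in tele.
pose e := (2 * x + 3) * (2 * p.-1%:R + 1) / (x + 2) ^+ 2.
have ep : e \in pint.
  by rewrite /e -exprVn; integrality.
have E : \sum_(k < p) sterm (x + 2) k =
    ((x + 1) / (x + 2)) ^+ 2 * \sum_(k < p) sterm x k + sterm (x + 1) p.-1 * e.
  apply: (mulfI (expf_neq0 2 nz)).
  by rewrite (canRL (subrK _) tele) /e; field.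
rewrite E -[X in eqmod_pint _ _ _ X]addr0; apply: eqmD; first exact: eqm_refl.
apply: eqm0Ml => //; rewrite /sterm.
apply: (@eqm0M 2 1); first apply: (@eqm0M 1 1); first exact: cbin_predp.
  by rewrite -E1; apply: gbinom_eqm0 => //; lia.
(* The residue p - (j + 2) is below p - 1, so the last factor vanishes modulo p as well. *)
have -> : - 1 - (x + 1) = (p - j.+2)%N%:R + P * (- s - 1).
  by rewrite natrB ?(ltnW lt_jp) // -E1 -!nat1r; ring.
by apply: gbinom_eqm0; [rewrite rpredB ?rpredN ?rpred1 | lia].
Qed.

Lemma Ssum_prod r s : s \in pint -> (2 * r < p)%N ->
  Ssum p ((2 * r)%:R + P * s) ==
    (\prod_(i < r) (((2 * i).+1%:R + P * s) / ((2 * i).+2%:R + P * s))) ^+ 2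
      * Ssum p (P * s) %[pmod 3].
Proof.
move=> sp; elim: r => [_|r IHr lt_rp].
  by rewrite big_ord0 expr1n mul1r add0r eqm_refl.
rewrite big_ord_recr /= exprMn [_ ^+ 2 * _]mulrC -mulrA.
have E : (2 * r.+1 = (2 * r).+2)%N by lia.
rewrite E in lt_rp *; apply: eqm_trans (Ssum_step sp lt_rp) _.
apply: eqmMl; last by apply: IHr; lia.
have [_ invp] := pintegral_unit (n := (2 * r).+2) lt_rp sp.
by rewrite rpredX // rpredM // rpredD ?rpred_nat ?pintPM.
Qed.

(** * Harmonic sums modulo p *)

Lemma harmonic_pint j n : (n < p)%N -> harmonic j n \in pint.
Proof.
move=> lt_np; rewrite /harmonic; apply: rpred_sum => i _.
rewrite -exprVn rpredX // pint_invn //= (leq_ltn_trans (ltn_ord i) lt_np) //.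
Qed.

Lemma gbinom_predp k : (k < p)%N ->
  (- 1) ^+ k * gbinom p.-1%:R k == 1 %[pmod 1].
Proof.
move=> lt_kp; rewrite gbinom_prod.
apply: eqm_prod1 => i.
have inv_pint : i.+1%:R^-1 \in pint.
  by apply: pint_invn; rewrite /= (leq_ltn_trans (ltn_ord i) lt_kp).
apply: (@eqm_quot _ (- i.+1%:R^-1)); first by integrality.
have -> : p.-1%:R = P - 1 by rewrite -[X in X%:R - 1]p_predK -nat1r; ring.
by rewrite -nat1r; field; rewrite natS_neq0.
Qed.

Lemma pint_rev_inv (i : 'I_p.-1) :
  [/\ i.+1%:R^-1 \in pint, (rev_ord i).+1%:R^-1 \in pint,
      i.+1%:R != 0 :> rat, (rev_ord i).+1%:R != 0 :> rat
    & (rev_ord i).+1%:R = P - i.+1%:R].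
Proof.
have := ltn_ord i; have := prime_gt0 p_pr => p0 lt_i.
have lt1 : (0 < i.+1 < p)%N by move: lt_i; clear -p0; lia.
have lt2 : (0 < (rev_ord i).+1 < p)%N by move: lt_i => /=; clear -p0; lia.
split; rewrite ?pnatr_eq0 ?pint_invn // -natrB; last by lia.
by congr _%:R => /=; lia.
Qed.

(** Pair k with p - k: 1 / k + 1 / (p - k) = p / (k (p - k)). *)
Lemma harmonic1_predp : harmonic 1 p.-1 == 0 %[pmod 1].
Proof.
have E : harmonic 1 p.-1 + harmonic 1 p.-1 == 0 %[pmod 1].
  rewrite {2}/harmonic (reindex_inj rev_ord_inj) -big_split.
  apply: eqm_sum0 => i /=.
  have [ip rp i0 r0 rE] := pint_rev_inv i; rewrite /= in rp r0 rE.
  apply: (@eqm_quot _ (i.+1%:R^-1 / (p.-1 - i.+1).+1%:R)); first by integrality.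
  rewrite !expr1; rewrite rE in r0 *.
  by field; rewrite !nat1r r0.
have := eqm0Ml E pint_inv2; set h := harmonic _ _.
by have -> : (h + h) / 2 = h by field.
Qed.

(** Makes 3 invertible modulo p, for the vanishing of [harmonic 2 p.-1]; at p = 3 that sum is
    5/4. *)
Hypothesis p_gt3 : (3 < p)%N.

(* Since (-1)^k C(p - 1, k) = 1 modulo p, [altsum_bin2] at n = p - 1 reads
   h = - h / 2 modulo p. *)
Lemma harmonic2_predp : harmonic 2 p.-1 == 0 %[pmod 1].
Proof.
set h := harmonic 2 _.
have hp : harmonic 1 p.-1 \in pint by apply: harmonic_pint; rewrite p_predK.
have i2 := pint_inv2; have i3 : 3^-1 \in pint by exact: pint_invn.
have alt : - ((harmonic 1 p.-1 ^+ 2 + h) / 2) == h %[pmod 1].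
  rewrite -(altsum_bin2 _ _ (leqnn _)); apply: eqm_sum => k.
  rewrite -[X in eqmod_pint _ _ _ X]mul1r -exprVn.
  have lt_kp : (k.+1 < p)%N by have := ltn_ord k; lia.
  have ip : k.+1%:R^-1 \in pint by exact: pint_invn.
  apply: eqmM; [by integrality|exact: rpred1|exact: gbinom_predp|exact: eqm_refl].
have [e ep E] := eqm_quotP alt; have [f fp F] := eqm_quotP harmonic1_predp.
apply: (@eqm_quot _ (- (2 * e + harmonic 1 p.-1 * f) / 3));
  first by integrality.
have H : 3 * h = - (2 * (P * e)) - harmonic 1 p.-1 * (P * f).
  by move: E; rewrite expr2 {2}F !expr1 add0r; lra.
by apply: (mulfI (x := 3)); rewrite // H; field.
Qed.

(** The squares of k and p - k agree modulo p, so the sum up to p - 1 is twice the sum up to m. *)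
Lemma harmonic2_half : harmonic 2 m == 0 %[pmod 1].
Proof.
have i2 := pint_inv2.
have E : harmonic 2 m + harmonic 2 m == harmonic 2 p.-1 %[pmod 1].
  have -> : p.-1 = (m + m)%N by rewrite p_eq; lia.
  rewrite [X in eqmod_pint _ _ _ X]/harmonic big_split_ord /=.
  apply: eqmD; first exact: eqm_refl.
  rewrite /harmonic (reindex_inj rev_ord_inj); apply: eqm_sum => i /=.
  have lt_i := ltn_ord i.
  have inv_pint k : (0 < k < p)%N -> k%:R^-1 \in pint by exact: pint_invn.
  set u : nat := (m - i.+1).+1; set v := (m + i).+1.
  have up : u%:R^-1 \in pint by apply: pint_invn; rewrite /u; lia.
  have vp : v%:R^-1 \in pint by apply: pint_invn; rewrite /v; lia.
  have vE : v%:R = P - u%:R by rewrite -natrB; [congr _%:R|]; rewrite /u /v; lia.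
  have u0 : u%:R != 0 :> rat by rewrite pnatr_eq0.
  have v0 : v%:R != 0 :> rat by rewrite pnatr_eq0.
  apply: (@eqm_quot _ ((v%:R - u%:R) * u%:R ^- 2 * v%:R ^- 2)).
    by rewrite -!exprVn; integrality.
  rewrite vE in v0 *; field; exact/andP.
have := eqm0Ml (eqm_trans E harmonic2_predp) pint_inv2; set h := harmonic _ _.
by have -> : (h + h) / 2 = h by field.
Qed.

(** * Morley's congruence and the Fermat quotient *)

Definition Lprod (z : rat) : rat := \prod_(j < m) (1 - P * z / j.+1%:R).

Lemma inv_pint_half (j : 'I_m) : j.+1%:R^-1 \in pint.
Proof. by apply: pint_invn; have := ltn_ord j; lia. Qed.

Lemma Lprod_pint z : z \in pint -> Lprod z \in pint.
Proof.
move=> zp; apply: rpred_prod => j _; have := inv_pint_half j => jp.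
by integrality.
Qed.

Lemma Lprod_linear z : z \in pint -> Lprod z == 1 - P * z * harmonic 1 m %[pmod 2].
Proof.
move=> zp; rewrite /Lprod.
have : (m < p)%N by lia.
elim: m => [_|n IHn lt_np];
  first by rewrite /harmonic !big_ord0 mulr0 subr0 eqm_refl.
have [e ep E] := eqm_quotP (IHn (ltnW lt_np)).
have ip : n.+1%:R^-1 \in pint by exact: pint_invn.
have hp := @harmonic_pint 1 n (ltnW lt_np).
have -> : harmonic 1 n.+1 = harmonic 1 n + n.+1%:R^-1.
  by rewrite /harmonic big_ord_recr /= expr1.
rewrite big_ord_recr /= E.
apply: (@eqm_quot _ (z ^+ 2 * harmonic 1 n / n.+1%:R + e * (1 - P * z / n.+1%:R))).
  by integrality.
by ring.
Qed.

Lemma Lprod_eqm1 z : z \in pint -> Lprod z == 1 %[pmod 1].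
Proof.
move=> zp; apply: eqm_trans (eqm_weak _ (Lprod_linear zp)) _ => //.
have hp : harmonic 1 m \in pint by apply: harmonic_pint; lia.
by apply: (@eqm_quot _ (- (z * harmonic 1 m))); [integrality | ring].
Qed.

(** With y = 1 / j, (1 - p y / 2)^2 = (1 - p y) + p^2 y^2 / 4. The corrections add up to p^2 / 4
    times [harmonic 2 m] modulo p^3. *)
Lemma Lprod_half_sqr : Lprod 2^-1 ^+ 2 == Lprod 1 %[pmod 3].
Proof.
have i2 := pint_inv2.
suff H : Lprod 2^-1 ^+ 2 == Lprod 1 + P ^+ 2 / 4 * harmonic 2 m %[pmod 3].
  apply: eqm_trans H _; have [e ep ->] := eqm_quotP harmonic2_half.
  apply: (@eqm_quot _ (2^-1 * 2^-1 * e)); first by integrality.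
  by field.
rewrite /Lprod; have : (m < p)%N by lia.
elim: m => [_|n IHn lt_np].
  by rewrite /harmonic !big_ord0 mulr0 addr0 expr1n eqm_refl.
have [e ep E] := eqm_quotP (IHn (ltnW lt_np)).
have ip : n.+1%:R^-1 \in pint by exact: pint_invn.
have hp := @harmonic_pint 2 n (ltnW lt_np).
have -> : harmonic 2 n.+1 = harmonic 2 n + n.+1%:R ^- 2.
  by rewrite /harmonic big_ord_recr.
rewrite !big_ord_recr /= exprMn E.
set A := \prod_(i < n) _.
(* The new correction p^2 y^2 / 4 is multiplied by A, so A is needed only modulo p. *)
have [f fp F] : exists2 f, f \in pint & A = 1 + P ^+ 1 * f.
  apply: eqm_quotP; apply: eqm_prod1 => i.
  have jp : i.+1%:R^-1 \in pint by apply: pint_invn; have := ltn_ord i; lia.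
  by apply: (@eqm_quot _ (- i.+1%:R^-1)); [integrality | ring].
set y := n.+1%:R^-1 in ip *; rewrite -exprVn -/y.
have y2 : (P * 2^-1 / n.+1%:R) = P * y / 2 by rewrite -/y; field.
rewrite y2; set h := harmonic 2 n in hp *.
apply: (@eqm_quot _ (f * y ^+ 2 * 2^-1 ^+ 2
   + 2^-1 ^+ 2 * h * (- y + P * y ^+ 2 * 2^-1 ^+ 2)
   + e * (1 - P * y / 2) ^+ 2)); first by integrality.
by rewrite F; field.
Qed.

(** Reversing the order of the numerators alone turns the factors into (p - 2j) / (2j) = -(1 - p /
    (2j)). *)
Lemma cbin_half : cbin m = (- 1) ^+ m * Lprod 2^-1.
Proof.
rewrite cbin_prod big_split (reindex_inj rev_ord_inj) /= -big_split.
have -> : (- 1) ^+ m = \prod_(i < m) (- 1) :> rat by rewrite prodr_const card_ord.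
rewrite /Lprod -big_split; apply: eq_bigr => i _ /=.
rewrite natrB ?ltn_ord // PE -nat1r; field.
by rewrite natS_neq0 doubleS_neq0.
Qed.

Lemma central_bin_Lprod : 'C(2 * m, m)%:R = (- 1) ^+ m * Lprod 1.
Proof.
rewrite -gbinom_nat; apply: (canRL (signrMK m)); rewrite gbinom_prod.
apply: eq_bigr => i _; have := PE; rewrite -nat1r natrM => ->.
by field; rewrite natS_neq0.
Qed.

Local Notation q := (fermat_quot2 p).

Lemma two_exp : 2 ^+ p.-1 = 1 + P * q.
Proof. by rewrite /fermat_quot2; field; exact: prime_neq0. Qed.

(** The ratio of C(2m, m) to [cbin m] is 4^m = 2^(p - 1). *)
Lemma Lprod_fermat : Lprod 1 = (1 + P * q) * Lprod 2^-1.
Proof.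
apply: (can_inj (signrMK m)); rewrite mulrCA -central_bin_Lprod -cbin_half.
rewrite -two_exp p_eq /= exprM /cbin; have -> : 2 ^+ 2 = 4 :> rat by ring.
by field; rewrite expf_eq0 andbF.
Qed.

Lemma Lprod_half_inv : Lprod 2^-1 != 0 /\ (Lprod 2^-1)^-1 \in pint.
Proof.
have [f fp ->] := eqm_quotP (Lprod_eqm1 pint_inv2).
by rewrite expr1; apply: (pintegral_unit (n := 1)) => //; rewrite prime_gt1.
Qed.

(** By [Lprod_fermat], p q = (L 1 - L (1/2)) / L (1/2), and both values of L are 1 modulo p. *)
Lemma fermat_quot2_pint : q \in pint.
Proof.
have [nz invp] := Lprod_half_inv.
have /eqm_quotP[f fp F] : Lprod 1 == Lprod 2^-1 %[pmod 1].
  apply: eqm_trans (Lprod_eqm1 (rpred1 _)) _.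
  by rewrite eqm_sym Lprod_eqm1 // pint_inv2.
have -> : q = f / Lprod 2^-1; last by integrality.
apply: (mulfI prime_neq0); apply: (mulIf nz).
have -> : P * (f / Lprod 2^-1) * Lprod 2^-1 = P * f by field.
by move: F; rewrite Lprod_fermat expr1; lra.
Qed.

(** Cancel the unit L (1/2) from L (1/2)^2 = L 1 = (1 + p q) L (1/2). *)
Lemma Lprod_half : Lprod 2^-1 == 1 + P * q %[pmod 3].
Proof.
have [nz invp] := Lprod_half_inv.
have := eqmMl invp Lprod_half_sqr.
by rewrite Lprod_fermat expr2 mulKf // mulrC mulfK.
Qed.

(** Compare the two expansions of L (1/2) modulo p^2, namely 1 - p h / 2 and 1 + p q. *)
Lemma harmonic1_half : harmonic 1 m == - (2 * q) %[pmod 1].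
Proof.
have i2 := pint_inv2; have qp := fermat_quot2_pint.
have hp : harmonic 1 m \in pint by apply: harmonic_pint; lia.
have [e ep E] := eqm_quotP (eqm_weak (isT : (2 <= 3)%N) Lprod_half).
have [f fp F] := eqm_quotP (Lprod_linear i2).
apply: (@eqm_quot _ (2 * (f - e))); first by integrality.
apply: (mulfI prime_neq0); rewrite expr1.
by move: F; rewrite E; lra.
Qed.

(** * Values of [Ssum] at multiples of p *)

Lemma gbinom_pair s k : s \in pint -> (k.+1 < p)%N ->
  gbinom (P * s) k.+1 * gbinom (- 1 - P * s) k.+1 ==
    - (P * s / k.+1%:R + (P * s) ^+ 2 / k.+1%:R ^+ 2) %[pmod 3].
Proof.
move=> sp; elim: k => [_|k IHk lt_kp].
  by rewrite !gbinomS !gbinom0; apply: (@eqm_quot _ 0); [exact: rpred0 | field].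
have [e ep E] := eqm_quotP (IHk (ltnW lt_kp)).
have ip : k.+1%:R^-1 \in pint by apply: pint_invn; rewrite /= ltnW.
have jp : k.+2%:R^-1 \in pint by exact: pint_invn.
have nz : k.+1%:R != 0 :> rat by rewrite pnatr_eq0.
have nz' : 1 + k.+1%:R != 0 :> rat by rewrite nat1r pnatr_eq0.
rewrite gbinomS (gbinomS (- 1 - P * s)).
have -> : forall g h u v w : rat, g * u / w * (h * v / w) = (g * h) * (u * v / w ^+ 2).
  by move=> *; rewrite invfM; ring.
rewrite E; set n := k.+1%:R in ip nz nz' *.
(* With x = p s, the step multiplies by (n - x) (n + 1 + x) / (n + 1)^2. As (n + x) (n - x) = n^2 -
   x^2, the only new error is the x^3 term, the first summand here. *)
apply: (@eqm_quot _ (s ^+ 3 * n^-1 ^+ 2 * (n + 1 + P * s) * k.+2%:R^-1 ^+ 2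
   + e * ((P * s - n) * (- 1 - P * s - n)) * k.+2%:R^-1 ^+ 2)).
  by rewrite /n; integrality.
by rewrite -[k.+2%:R]nat1r -/n; field; rewrite !nat1r !pnatr_eq0.
Qed.

(** The sums H (j = 1) and K (j = 2) of the overview. *)
Definition cbin_harmonic (j : nat) : rat :=
  \sum_(k < p.-1) cbin k.+1 / k.+1%:R ^+ j.

Lemma lt_ord_predp (k : 'I_p.-1) : (k.+1 < p)%N.
Proof. by have := ltn_ord k; lia. Qed.

Lemma cbin_harmonic_pint j : cbin_harmonic j \in pint.
Proof.
apply: rpred_sum => k _; rewrite -exprVn.
have ip := pint_invn (lt_ord_predp k : (0 < k.+1 < p)%N).
by have cp := cbin_pint (lt_ord_predp k); integrality.
Qed.

Lemma Ssum_small s : s \in pint ->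
  Ssum p (P * s) ==
    1 - P * s * cbin_harmonic 1 - (P * s) ^+ 2 * cbin_harmonic 2 %[pmod 3].
Proof.
move=> sp; rewrite SsumE sum_p_recl.
rewrite -addrA; apply: eqmD.
  by rewrite /sterm cbin0 !gbinom0 !mul1r eqm_refl.
rewrite /cbin_harmonic !mulr_sumr -!sumrN -big_split; apply: eqm_sum => k /=.
rewrite /sterm -mulrA.
have -> : - (P * s * (cbin k.+1 / k.+1%:R ^+ 1))
     - (P * s) ^+ 2 * (cbin k.+1 / k.+1%:R ^+ 2) =
   cbin k.+1 * (- (P * s / k.+1%:R + (P * s) ^+ 2 / k.+1%:R ^+ 2)) by ring.
by apply: eqmMl; [apply: cbin_pint | apply: gbinom_pair] => //; exact: lt_ord_predp.
Qed.

(** Modulo p, [cbin k] becomes (-1)^k C(m, k), so [altsum_bin2] applies with n = m and N = p - 1.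
    Then insert [harmonic 1 m] = -2 q and [harmonic 2 m] = 0. *)
Lemma cbin_harmonic2 : cbin_harmonic 2 == - (2 * q ^+ 2) %[pmod 1].
Proof.
have i2 := pint_inv2; have qp := fermat_quot2_pint.
have hp : harmonic 1 m \in pint by apply: harmonic_pint; lia.
have /eqm_trans-> // :
    cbin_harmonic 2 == - ((harmonic 1 m ^+ 2 + harmonic 2 m) / 2) %[pmod 1].
  have le_m : (m <= p.-1)%N by lia.
  rewrite -(altsum_bin2 _ _ le_m); apply: eqm_sum => k; rewrite -exprVn.
  rewrite mulrC [X in eqmod_pint _ _ _ X]mulrC.
  have ip := pint_invn (lt_ord_predp k : (0 < k.+1 < p)%N).
  by apply: eqmMl; [integrality | apply: cbin_gbinom; exact: lt_ord_predp].
have [e ep E] := eqm_quotP harmonic1_half; have [f fp F] := eqm_quotP harmonic2_half.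
apply: (@eqm_quot _ (- (f - 4 * q * e + P * e ^+ 2) * 2^-1));
  first by integrality.
by rewrite E F; field.
Qed.

Lemma Ssum_minusp : Ssum p (P * - 1) == (1 + P * q) ^+ 2 %[pmod 3].
Proof.
have qp := fermat_quot2_pint.
(* The symmetry sends -p to p - 1 = 2m, which m steps of the recurrence reduce to [Ssum p 0], that
   is 1. *)
have -> : Ssum p (P * - 1) = Ssum p ((2 * m)%:R + P * 0).
  rewrite !SsumE; apply: eq_bigr => k _; rewrite -sterm_sym; congr sterm.
  by rewrite natrM PE; ring.
have lt_m : (2 * m < p)%N by lia.
apply: eqm_trans (Ssum_prod (rpred0 _) lt_m) _.
have -> : \prod_(i < m) (((2 * i).+1%:R + P * 0) / ((2 * i).+2%:R + P * 0)) =
    (- 1) ^+ m * Lprod 2^-1.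
  rewrite -cbin_half cbin_prod; apply: eq_bigr => i _.
  by rewrite mulr0 !addr0 -!nat1r natrM; congr (_ / _); ring.
have Lp := Lprod_pint pint_inv2.
rewrite exprMn sqrr_sign mul1r -[X in eqmod_pint _ _ _ X]mulr1.
apply: eqmM; [|by integrality| |].
- apply: eqm_pint (Ssum_small (rpred0 _)) => //.
  by rewrite mulr0 expr0n !mul0r !subr0 rpred1.
- by apply: eqmM => //; [by integrality | exact: Lprod_half | exact: Lprod_half].
apply: eqm_trans (Ssum_small (rpred0 _)) _.
by rewrite mulr0 expr0n !mul0r !subr0 eqm_refl.
Qed.

Lemma Ssum_small_inverse t : t \in pint ->
  Ssum p (P * (2 * t)) *
    (1 + 4 * t * P * q + 2 * t * (4 * t - 1) * P ^+ 2 * q ^+ 2)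
    == 1 %[pmod 3].
Proof.
move=> tp; have qp := fermat_quot2_pint.
set H := cbin_harmonic 1; set K := cbin_harmonic 2.
have Hp : H \in pint by exact: cbin_harmonic_pint.
have Kp : K \in pint by exact: cbin_harmonic_pint.
have [e ep Ke] := eqm_quotP cbin_harmonic2; rewrite -/K in Ke.
(* Taking s = -1 gives 1 + p H - p^2 K = (1 + p q)^2 modulo p^3; solve for p H with K = -2 q^2
   modulo p. *)
have [f fp PH] : exists2 f, f \in pint &
    P * H = 2 * P * q - P ^+ 2 * q ^+ 2 + P ^+ 3 * f.
  have m1p : - 1 \in pint by rewrite rpredN rpred1.
  have := Ssum_small m1p; rewrite eqm_sym => /eqm_trans/(_ Ssum_minusp).
  move=> /eqm_quotP[f fp F]; rewrite -/H -/K in F.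
  exists (f + e); first by integrality.
  by move: F; rewrite Ke expr1; lra.
have t2p : 2 * t \in pint by integrality.
have [g gp ->] := eqm_quotP (Ssum_small t2p); rewrite -/H -/K.
pose E := 1 + 4 * t * P * q + 2 * t * (4 * t - 1) * P ^+ 2 * q ^+ 2.
have Ep : E \in pint by rewrite /E; integrality.
(* The sum is 1 - p a + p^2 c modulo p^3 and E = 1 + p a + p^2 b. Since b + c = a^2, their product
   is 1 up to order p^3. *)
pose a := 4 * t * q; pose b := 2 * t * (4 * t - 1) * q ^+ 2.
pose c := 2 * t * q ^+ 2 + 8 * t ^+ 2 * q ^+ 2.
apply: (@eqm_quot _ (c * a + b * (P * c - a)
   + (g - 2 * t * f - 4 * t ^+ 2 * e) * E)); first by rewrite /a /b /c; integrality.
rewrite -/E.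
have -> : 1 - P * (2 * t) * H - (P * (2 * t)) ^+ 2 * K + P ^+ 3 * g =
   1 - 2 * t * (P * H) - 4 * t ^+ 2 * P ^+ 2 * K + P ^+ 3 * g by ring.
by rewrite PH Ke /E /a /b /c; ring.
Qed.

(** * Comparison of the two sums *)

Lemma Qsum_div_prod r t : t \in pint -> (r < p)%N ->
  Qsum p (r%:R + P * t) / P ==
    t * \prod_(i < r) (- (2 * (2 * (i%:R + P * t) + 1) / (i.+1%:R + P * t)))
  %[pmod 3].
Proof.
(* Dividing by p costs one power of p, hence the modulus p^4 in [Qsum_prod]. *)
move=> tp lt_rp; rewrite -(eqm_scale 3 1) expr1 [P * (t * _)]mulrA.
by rewrite [P * (_ / P)]mulrC divfK ?prime_neq0 //; exact: Qsum_prod.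
Qed.

Lemma Qsum_Ssum_congruence r t : t \in pint -> (2 * r < p)%N ->
  (Qsum p (r%:R + P * t) / P) ^+ 2 ==
    2 ^+ (4 * r) * t ^+ 2 * Ssum p (2 * (r%:R + P * t)) *
      (1 + 4 * t * P * q + 2 * t * (4 * t - 1) * P ^+ 2 * q ^+ 2) %[pmod 3].
Proof.
move=> tp lt_rp; have qp := fermat_quot2_pint.
have -> : 2 * (r%:R + P * t) = (2 * r)%:R + P * (2 * t) by rewrite natrM; ring.
set C := \prod_(i < r) (- (2 * (2 * (i%:R + P * t) + 1) / (i.+1%:R + P * t))).
have t2p : 2 * t \in pint by integrality.
set D := \prod_(i < r)
  (((2 * i).+1%:R + P * (2 * t)) / ((2 * i).+2%:R + P * (2 * t))).
(* Each factor of C is -4 times the matching factor of D; squaring removes the sign. *)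
have CD : C ^+ 2 = 2 ^+ (4 * r) * D ^+ 2.
  have -> : 2 ^+ (4 * r) = \prod_(i < r) (2 ^+ 4) :> rat.
    by rewrite prodr_const card_ord -exprM.
  rewrite /C /D -!prodrXl -big_split; apply: eq_bigr => i _ /=.
  have lt_i := ltn_ord i.
  have [nz _] := pintegral_unit (n := i.+1) (ltac:(lia) : (0 < i.+1 < p)%N) tp.
  have -> : (2 * i).+2%:R + P * (2 * t) = 2 * (i.+1%:R + P * t).
    by rewrite -!nat1r natrM; ring.
  have -> : (2 * i).+1%:R + P * (2 * t) = 2 * (i%:R + P * t) + 1.
    by rewrite -nat1r natrM; ring.
  by field; rewrite nat1r.
have Cp : C \in pint.
  apply: rpred_prod => i _; have lt_i := ltn_ord i.
  have [_ ip] := pintegral_unit (n := i.+1) (ltac:(lia) : (0 < i.+1 < p)%N) tp.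
  by integrality.
have Dp : D \in pint.
  apply: rpred_prod => i _; have lt_i := ltn_ord i.
  have [_ ip] := pintegral_unit (n := (2 * i).+2)
    (ltac:(lia) : (0 < (2 * i).+2 < p)%N) t2p.
  by integrality.
have lt_r : (r < p)%N by lia.
have QC := Qsum_div_prod tp lt_r; rewrite -/C in QC.
apply: (@eqm_trans _ ((t * C) ^+ 2)).
  have tCp : t * C \in pint by integrality.
  by apply: eqmM => //; apply: eqm_pint QC.
rewrite eqm_sym [(t * C) ^+ 2]exprMn CD; set E := (1 + _ + _).
have Ep : E \in pint by rewrite /E; integrality.
have SD := Ssum_prod t2p lt_rp; rewrite -/D in SD.
set S1 := Ssum p (_ + _) in SD *; set S0 := Ssum p _ in SD *.
set A := 2 ^+ (4 * r) * t ^+ 2; have Ap : A \in pint by rewrite /A; integrality.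
rewrite -mulrA.
have -> : t ^+ 2 * (2 ^+ (4 * r) * D ^+ 2) = A * (D ^+ 2 * 1) by rewrite /A; ring.
apply: eqmMl => //.
(* S1 = D^2 S0 modulo p^3, and E is inverse to S0, so only D^2 remains. *)
apply: (@eqm_trans _ (D ^+ 2 * (S0 * E))).
  by rewrite mulrA ![_ * E]mulrC; exact: eqmMl.
by apply: eqmMl; [integrality | exact: Ssum_small_inverse].
Qed.

End Congruences.

Theorem theorem5p2 (p : nat) (a : rat)
    (p_pr : prime p) (p_odd : odd p) (p_neq3 : p != 3%N)
    (a_int : a \in pintegral p)
    (resid_ge1 : (1 <= resid p a)%N)
    (resid_lt : (resid p a)%:R < p%:R / 2 :> rat) :
  let a' := pquot p a in
  let q := fermat_quot2 p in
  eqmod_pint p 3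
    ((Qsum p a / p%:R) ^+ 2)
    (2 ^+ (4 * resid p a) * a' ^+ 2 * Ssum p (2 * a) *
       (1 + 4 * a' * p%:R * q
          + 2 * a' * (4 * a' - 1) * p%:R ^+ 2 * q ^+ 2)).
Proof.
cbv zeta; set a' := pquot p a.
(* The congruence of a with its residue modulo p unfolds to the integrality of this quotient. *)
have a'_int : a' \in pintegral p.
  by have := resid_uniq (resid p a) p_pr a_int; rewrite eqxx => /esym/andP[].
have aE : a = (resid p a)%:R + p%:R * a'.
  by rewrite /a' /pquot; field; exact: prime_neq0.
have p_eq : p = (2 * p./2).+1.
  by rewrite -[LHS]odd_double_half p_odd mul2n.
have p_gt3 : (3 < p)%N by have := prime_gt1 p_pr; move: p_neq3; lia.
have lt_r : (2 * resid p a < p)%N.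
  by move: resid_lt; rewrite ltr_pdivlMr // -natrM ltr_nat mulnC.
have := Qsum_Ssum_congruence p_pr p_eq p_gt3 a'_int lt_r.
by rewrite -aE.
Qed.
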